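(* Let $G=(V,E)$ be an infinite graph, let $\omega$ be an end of $G$ with end tangle $\tau=\tau_\omega$, and let $k\in\mathbb{N}$. Then the following are equivalent: (i) $\tau\cap\vec S_k$ is closed; (ii) $\deg(\omega)+\mathrm{dom}(\omega)\ge k$; (iii) $\tau\cap\vec S_k$ has a finite relative decider; (iv) $\tau\cap\vec S_k$ has a relative decider of size exactly $k$.
   Context: A separation of $G$ is a set $\{A,B\}$ with $A\cup B=V$ such that $G$ has no edge between $A\setminus B$ and $B\setminus A$; its orientations are $(A,B)$ and $(B,A)$, and its order is $|A\cap B|$. $\vec S$ is the set of all oriented separations $(A,B)$ of $G$ with $A\cap B$ finite; $\vec S_k$ is the set of those with $|A\cap B|<k$. Topology on $\vec S$: for every finite $Z\subseteq V$ and every oriented separation $(A_Z,B_Z)$ of $G[Z]$, the set of all $(A,B)\in\vec S$ with $A\cap Z=A_Z$, $B\cap Z=B_Z$ is a basic open set. ''Closed'' means closed in $\vec S$ (equivalently in $\vec S_k$). The end tangle of an end $\omega$ is $\tau_\omega=\{(A,B)\in\vec S : \text{every ray of }\omega\text{ has a tail in }B\}$. A set $X\subseteq V$ is a relative decider for $\tau\cap\vec S_k$ if $|A\cap X|<|B\cap X|$ for every $(A,B)\in\tau\cap\vec S_k$. $\deg(\omega)$ is the largest size of a family of pairwise disjoint rays in $\omega$ (possibly $\infty$). A vertex dominates $\omega$ if it sends infinitely many paths, disjoint except at that vertex, to some (equivalently every) ray of $\omega$; $\mathrm{dom}(\omega)$ is the number of vertices dominating $\omega$ (possibly $\infty$).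 *)

(* Defs.v *)
From HB Require Import structures.
From mathcomp Require Import all_boot all_order all_algebra.
From mathcomp Require Import mathcomp_extra boolp classical_sets functions.
From mathcomp Require Import cardinality constructive_ereal topology.

Set Implicit Arguments.
Unset Strict Implicit.
Unset Printing Implicit Defensive.

Local Open Scope classical_set_scope.
Local Open Scope card_scope.

(** Cardinalities *)

Definition card_lt {T U : Type} (A : set T) (B : set U) : bool :=
  (A #<= B) && (A #!= B).

(* Size in N + {oo}, with all infinite cardinals identified; N + {oo} is
   embedded in \bar int in order to reuse its order and addition. *)
Definition ecard {T : Type} (A : set T) : \bar int :=
  match pselect (finite_set A) with
  | left finA => (Posz (projT1 (cid finA)))%:E%E
  | right _ => +oo%E
  end.

(** Graphs, paths, rays and ends *)

Record sgraph := SGraph {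
  vertex :> choiceType;
  adj : rel vertex;
  adj_sym : symmetric adj;
  adj_irr : irreflexive adj }.

Section Graph.
Variable G : sgraph.

(* x and y are joined by a walk in G - S. *)
Definition linked (S : set G) (x y : G) : Prop :=
  exists p : seq G,
    [/\ path (@adj G) x p, last x p = y & forall z, z \in x :: p -> ~ S z].

Definition component (S C : set G) : Prop :=
  exists2 x, ~ S x & C = [set y | linked S x y].

(* A ray is determined by its sequence of vertices, listed from its first
   vertex. *)
Record ray := Ray {
  ray_seq :> nat -> G;
  ray_inj : injective ray_seq;
  ray_adj : forall n, adj (ray_seq n) (ray_seq n.+1) }.

Definition tail_in (r : ray) (B : set G) : Prop :=
  exists n, forall m, (n <= m)%N -> B (r m).

Definition ray_equiv (r r' : ray) : Prop :=
  forall S : set G, finite_set S ->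
    exists C, [/\ component S C, tail_in r C & tail_in r' C].

Definition is_end (w : set ray) : Prop :=
  exists r, w = [set r' | ray_equiv r r'].

Definition disjoint_rays (F : set ray) : Prop :=
  trivIset F (fun r => range r).

(* The supremum is attained: by a theorem of Halin, an end with arbitrarily
   large finite families of disjoint rays has an infinite one. *)
Definition deg (w : set ray) : \bar int :=
  supremum 0%E [set ecard F | F in [set F | F `<=` w /\ disjoint_rays F]].

(* A path starting at v is given by the sequence of its vertices other than v,
   so that "disjoint except at v" means that these sequences are disjoint. *)
Definition path_to_ray (v : G) (r : ray) (p : seq G) : Prop :=
  [/\ path (@adj G) v p, uniq (v :: p) & range r (last v p)].

Definition dominates (v : G) (w : set ray) : Prop :=
  exists2 r, w r &
    exists P : set (seq G),
      [/\ infinite_set P, P `<=` path_to_ray v r &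
          trivIset P (fun p => [set` p])].

Definition dom (w : set ray) : \bar int := ecard [set v | dominates v w].

(** Separations *)

(* (A, B) is an oriented separation of the induced subgraph G[Z]. *)
Definition is_sep (Z A B : set G) : Prop :=
  A `|` B = Z /\
  forall x y, (A `\` B) x -> (B `\` A) y -> ~~ adj x y.

(* The oriented separations of G of finite order. *)
Record fsep := FSep {
  lside : set G;
  rside : set G;
  fsep_sep : is_sep setT lside rside;
  fsep_fin : finite_set (lside `&` rside) }.

Definition fsep_lt (k : nat) : set fsep :=
  [set s | card_lt (lside s `&` rside s) `I_k].

Definition basic_open (Z AZ BZ : set G) : set fsep :=
  [set s | lside s `&` Z = AZ /\ rside s `&` Z = BZ].

Definition fsep_base : set (set fsep) :=
  [set U | exists Z AZ BZ,
    [/\ finite_set Z, is_sep Z AZ BZ & U = basic_open Z AZ BZ]].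

Lemma is_sep_restr (s : fsep) (Z : set G) :
  is_sep Z (lside s `&` Z) (rside s `&` Z).
Proof.
case: s => A B [/= AB noe] _; split; first by rewrite -setIUl AB setTI.
move=> x y [[Ax Zx] nBx] [[By Zy] nAy]; apply: noe; split => //.
- by move=> Bx; apply: nBx.
- by move=> Ay; apply: nAy.
Qed.

Lemma fsep_base_cover : \bigcup_(U in fsep_base) U = setT.
Proof.
apply/seteqP; split => // s _.
exists (basic_open set0 (lside s `&` set0) (rside s `&` set0)) => //.
exists set0, (lside s `&` set0), (rside s `&` set0).
by split => //; exact: is_sep_restr.
Qed.

Lemma fsep_base_join (U W : set fsep) (s : fsep) :
  fsep_base U -> fsep_base W -> U s -> W s ->
  exists X, [/\ fsep_base X, X s & X `<=` U `&` W].
Proof.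
move=> [Z [A [B [finZ _ ->]]]] [Z' [A' [B' [finZ' _ ->]]]] [sA sB] [sA' sB'].
pose Y := Z `|` Z'.
exists (basic_open Y (lside s `&` Y) (rside s `&` Y)); split => //.
- exists Y, (lside s `&` Y), (rside s `&` Y).
  by split => //; [rewrite finite_setU | exact: is_sep_restr].
- have restr (C D E : set G) : E `<=` Y -> C `&` Y = D `&` Y ->
      C `&` E = D `&` E.
    move=> EY CD; have -> : E = Y `&` E by rewrite setIC; apply/esym/setIidl.
    by rewrite !setIA CD.
  have ZY : Z `<=` Y by exact: subsetUl.
  have Z'Y : Z' `<=` Y by exact: subsetUr.
  move=> t [tA tB]; split; split.
  + by rewrite -sA; exact: restr tA.
  + by rewrite -sB; exact: restr tB.
  + by rewrite -sA'; exact: restr tA.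
  + by rewrite -sB'; exact: restr tB.
Qed.

HB.instance Definition _ := gen_eqMixin fsep.
HB.instance Definition _ := gen_choiceMixin fsep.
HB.instance Definition _ := @isBaseTopological.Build fsep
  (set fsep) fsep_base id fsep_base_cover fsep_base_join.

Definition end_tangle (w : set ray) : set fsep :=
  [set s | forall r, w r -> tail_in r (rside s)].

Definition relative_decider (T : set fsep) (X : set G) : Prop :=
  forall s, T s -> card_lt (lside s `&` X) (rside s `&` X).

End Graph.

(* Main.v *)
(* (i) => (ii): let D be the set of dominating vertices. If deg + dom < k, then
   D is finite and the separation (V, D), which is not in the end tangle, is in
   the closure of T: by a Menger argument, every finite Z is separated from the
   end in G - D by fewer than k - |D| vertices outside Z. Otherwise one chooses
   recursively disjoint finite separators S 0, S 1, ... of minimum size in G - D,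
   S n.+1 separating S n from the end; linking all of S n into S n.+1 for every
   n yields |S 0| >= k - |D| disjoint rays, and they belong to the end because
   no vertex stays forever beyond the S n.
   (ii) => (iv): a decider is made of dominating vertices and of vertices far out
   on disjoint rays; see family_decider.
   (iii) => (i): a separation s outside T has a neighbourhood avoiding T, given
   by its separator if the order of s is too large, and by the decider
   otherwise, as then the inverse of s is in T. *)

Require Import Defs.
From HB Require Import structures.
From mathcomp Require Import all_boot all_order all_algebra finmap zify.
From mathcomp Require Import mathcomp_extra boolp classical_sets functions.
From mathcomp Require Import cardinality constructive_ereal topology.

Set Implicit Arguments.
Unset Strict Implicit.
Unset Printing Implicit Defensive.

Local Open Scope classical_set_scope.
Local Open Scope card_scope.

Import Order.TTheory Num.Theory.

(** * Recursive choice, and connectivity outside a set of vertices *)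

Lemma disjoint_seq (T U : Type) (P : T -> Prop) (E : T -> set U) :
    (forall F : set U, finite_set F ->
       exists x, [/\ P x, finite_set (E x) & E x `&` F = set0]) ->
  exists x : nat -> T, (forall n, P (x n)) /\
    (forall i j, (i < j)%N -> E (x i) `&` E (x j) = set0).
Proof.
move=> H.
have [x0 _] := H _ (finite_set0 U).
have /choice[c cP] : forall F : set U, exists x, finite_set F ->
    [/\ P x, finite_set (E x) & E x `&` F = set0].
  move=> F; have [/H[x xP]|nF] := pselect (finite_set F); first by exists x.
  by exists x0 => /nF.
(* [Fs n] is the union of the sets chosen before stage [n]; avoiding it makes each new set disjoint
   from all earlier ones. *)
pose Fs := fix Fs n := if n is m.+1 then Fs m `|` E (c (Fs m)) else set0.
have finFs n : finite_set (Fs n).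
  elim: n => [|n IH] /=; first exact: finite_set0.
  by rewrite finite_setU; split=> //; have [] := cP _ IH.
have EFs i j : (i < j)%N -> E (c (Fs i)) `<=` Fs j.
  elim: j => // j IH; rewrite ltnS leq_eqVlt => /predU1P[->|/IH ij].
    exact: subsetUr.
  by apply: subset_trans ij _; exact: subsetUl.
exists (fun n => c (Fs n)); split=> [n|i j ij]; first by have [] := cP _ (finFs n).
have [_ _ EF] := cP _ (finFs j).
by rewrite -subset0 -EF => y [/(EFs _ _ ij) ? ?].
Qed.

Section Linked.
Variable G : sgraph.
Implicit Types (F W S Z : set G) (x y z : G).

Lemma linked_refl F x : ~ F x -> linked F x x.
Proof. by move=> Fx; exists [::]; split=> // z; rewrite inE => /eqP->. Qed.

Lemma linkedl F x y : linked F x y -> ~ F x.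
Proof. by move=> [p [_ _]]; apply; rewrite inE eqxx. Qed.

Lemma linkedr F x y : linked F x y -> ~ F y.
Proof. by move=> [p [_ <-]]; apply; exact: mem_last. Qed.

Lemma linked_trans F x y z : linked F x y -> linked F y z -> linked F x z.
Proof.
move=> [p [xp <- pF]] [q [yq <- qF]]; exists (p ++ q); split.
- by rewrite cat_path xp.
- by rewrite last_cat.
- move=> u; rewrite -cat_cons mem_cat => /orP[/pF//|uq].
  by apply: qF; rewrite inE uq orbT.
Qed.

Lemma linked_adj F x y : adj x y -> ~ F x -> ~ F y -> linked F x y.
Proof.
move=> xy Fx Fy; exists [:: y]; rewrite /= xy; split=> // z.
by rewrite !inE => /orP[]/eqP->.
Qed.

Lemma linked_step F x y z : linked F x y -> adj y z -> ~ F z -> linked F x z.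
Proof.
move=> xy yz Fz; apply: (linked_trans xy); apply: linked_adj => //.
exact: linkedr xy.
Qed.

Lemma linked_ind F (Q : G -> Prop) x y : Q x ->
    (forall u v, Q u -> adj u v -> ~ F u -> ~ F v -> Q v) ->
  linked F x y -> Q y.
Proof.
move=> Qx Qstep [p [+ <- +]]; elim: p x Qx => //= u p IH x Qx /andP[xu up] pF.
apply: (IH u) => // [|z zp]; last by apply: pF; rewrite inE zp orbT.
by apply: (Qstep x) => //; apply: pF; rewrite !inE eqxx ?orbT.
Qed.

Lemma linked_sym F x y : linked F x y -> linked F y x.
Proof.
move=> xy; have Fx := linkedl xy; move: xy.
apply: (@linked_ind F (fun u => linked F u x)); first exact: linked_refl.
move=> u v ux uv Fu Fv; apply: linked_trans ux.
by apply: linked_adj => //; rewrite adj_sym.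
Qed.

Lemma linked_sub F W x y : F `<=` W -> linked W x y -> linked F x y.
Proof. by move=> FW [p [xp px pW]]; exists p; split=> // z /pW nW /FW. Qed.

End Linked.

(** * The component of [G - F] in which a ray ends up *)

Section Home.
Variables (G : sgraph) (r : ray G).
Implicit Types (F W S Z : set G) (x y z v : G).

(* For finite F this is the component of G - F in which r has a tail. *)
Definition home F : set G :=
  [set y | exists n, forall m, (n <= m)%N -> linked F (r m) y].

Lemma home_linked F x y : home F x -> home F y -> linked F x y.
Proof.
move=> [n nx] [n' ny]; apply: (@linked_trans _ _ _ (r (maxn n n'))).
  by apply: linked_sym; apply: nx; exact: leq_maxl.
by apply: ny; exact: leq_maxr.
Qed.

Lemma linked_home F x y : home F x -> linked F x y -> home F y.
Proof. by move=> [n nx] xy; exists n => m /nx rx; exact: linked_trans xy. Qed.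

Lemma home_step F x y : home F x -> adj x y -> ~ F y -> home F y.
Proof. by move=> [n nx] xy Fy; exists n => m /nx rx; exact: linked_step xy _. Qed.

Lemma homeN F x : home F x -> ~ F x.
Proof. by move=> [n /(_ n (leqnn n))]; exact: linkedr. Qed.

Lemma home_sub F W : F `<=` W -> home W `<=` home F.
Proof. by move=> FW x [n nx]; exists n => m /nx; exact: linked_sub. Qed.

Lemma home_ray F x : home F x -> exists n, forall m, (n <= m)%N -> home F (r m).
Proof.
move=> Fx; have [n nx] := Fx; exists n => m /nx rx.
by apply: (linked_home Fx); exact: linked_sym.
Qed.

(** A walk in [G - F] that starts in [home r F] stays there, hence avoids [W], even if [F] and [W]
    are incomparable. *)
Lemma home_disjoint_sub F W : home F `&` W = set0 -> home F `<=` home W.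
Proof.
move=> FW x Fx; have nW u : home F u -> ~ W u.
  by move=> Fu Wu; suff : set0 u by []; rewrite -FW.
have [n nx] := Fx; have [n' nr] := home_ray Fx.
exists (maxn n n') => m; rewrite geq_max => /andP[/nx rx /nr Fr].
suff [] : linked W (r m) x /\ home F x by [].
move: rx; apply: (@linked_ind _ F (fun u => linked W (r m) u /\ home F u)).
  by split=> //; apply: linked_refl; exact: nW.
move=> u v [ru Fu] uv _ Fv; have Hv := home_step Fu uv Fv.
by split=> //; apply: linked_step uv _ => //; exact: nW.
Qed.

End Home.

Lemma ray_avoids (G : sgraph) (r : ray G) (F : set G) : finite_set F ->
  exists n, forall m, (n <= m)%N -> ~ F (r m).
Proof.
move=> finF; suff [n nP] : exists n, r @^-1` F `<=` `I_n.
  by exists n => m nm /nP /=; rewrite ltnNge nm.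
have : finite_set (r @^-1` F).
  by apply: finite_preimage finF; move=> i j _ _; exact: ray_inj.
move=> /finite_seqP[s sE]; exists (\max_(i <- s) i).+1 => i; rewrite sE /= => si.
by rewrite ltnS; exact: leq_bigmax_seq.
Qed.

Lemma ray_tail_linked (G : sgraph) (r : ray G) (F : set G) n :
    (forall m, (n <= m)%N -> ~ F (r m)) ->
  forall i j, (n <= i)%N -> (n <= j)%N -> linked F (r i) (r j).
Proof.
move=> nF; have H i : (n <= i)%N -> linked F (r n) (r i).
  move=> /subnKC <-; elim: (i - n)%N => [|d IH].
    by rewrite addn0; apply: linked_refl; exact: nF.
  rewrite addnS; apply: linked_step IH (ray_adj _ _) _.
  by apply: nF; rewrite -addnS leq_addr.
move=> i j ni nj; apply: linked_trans (H j nj); apply: linked_sym; exact: H.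
Qed.

Lemma ray_home (G : sgraph) (r : ray G) (F : set G) : finite_set F ->
  exists n, forall m, (n <= m)%N -> home r F (r m).
Proof.
move=> /(ray_avoids r)[n nF]; exists n => m nm; exists n => m' nm'.
exact: ray_tail_linked nF _ _ nm' nm.
Qed.

(** The component that equivalence asks for can only be the one holding a tail of [r], that is
    [home r F]. *)
Lemma ray_equivP (G : sgraph) (r r' : ray G) :
  ray_equiv r r' <-> forall F, finite_set F -> tail_in r' (home r F).
Proof.
split=> [rr' F /[dup] finF /rr'[C [[x _ ->] [n nr] [n' nr']]]|H F finF].
  have [n1 n1r] := ray_home r finF.
  exists n' => m /nr' xr'; apply: (linked_home (n1r (maxn n n1) (leq_maxr _ _))).
  apply: linked_trans xr'; apply: linked_sym; apply: nr; exact: leq_maxl.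
have [n nr] := ray_home r finF; have [n' nr'] := H F finF.
have Fn := nr _ (leqnn n).
exists (home r F); split; [exists (r n)|by exists n|by exists n'].
  exact: homeN Fn.
by apply/seteqP; split=> y; [exact: home_linked|exact: linked_home].
Qed.

(** * Sizes of finite sets *)

Definition fcard {T : choiceType} (A : set T) : nat := #|` fset_set A|%fset.

Lemma fcard_sub (T : choiceType) (A B : set T) :
  finite_set B -> A `<=` B -> (fcard A <= fcard B)%N.
Proof.
move=> finB AB; apply: fsubset_leq_card.
by rewrite -fset_set_sub //; exact: sub_finite_set finB.
Qed.

Lemma fcardU (T : choiceType) (A B : set T) : finite_set A -> finite_set B ->
  A `&` B = set0 -> fcard (A `|` B) = (fcard A + fcard B)%N.
Proof.
move=> finA finB AB; rewrite /fcard fset_setU // cardfsU -fset_setI // AB.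
by rewrite fset_set0 cardfs0 subn0.
Qed.

Lemma fcardU_le (T : choiceType) (A B : set T) : finite_set A -> finite_set B ->
  (fcard (A `|` B) <= fcard A + fcard B)%N.
Proof. by move=> finA finB; rewrite /fcard fset_setU // cardfsU leq_subr. Qed.

Lemma fcard_image (T U : choiceType) (f : T -> U) (A : set T) : finite_set A ->
  (fcard (f @` A) <= fcard A)%N.
Proof. by move=> finA; rewrite /fcard fset_set_image //; exact: leq_imfset_card. Qed.

Lemma fcard1 (T : choiceType) (x : T) : fcard [set x] = 1%N.
Proof. by rewrite /fcard fset_set1 cardfs1. Qed.

(** * Augmenting paths and linkages *)

Section Linkage.
Variables (T : choiceType) (R : T -> T -> Prop).
Implicit Types (A B U S X : set T) (f : T -> T) (x y s : T).

Definition neighbours X : set T := [set y | exists2 x, X x & R x y].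

Record matching A B f : Prop := Matching {
  matching_inj : {in A &, injective f};
  matching_img : forall x, A x -> B (f x);
  matching_rel : forall x, A x -> R x (f x);
  matching_fin : finite_set [set x | A x /\ f x <> x] }.

(** A step from [x] to [x'] means that [x] may take over the partner [f x'] of [x']; it stands for
    two edges of a usual alternating path. *)
Definition alternating A f : rel T := fun x x' => `[< A x' /\ R x (f x') >].

(** Partners are shifted along the path: each vertex takes the partner of its successor, and the
    last one takes the free vertex [y]. In the induction, [x] gives its partner to [s] and becomes
    the new unmatched source. *)
Lemma alternating_augment A B f s p y : matching A B f -> ~ A s ->
    path (alternating A f) s p -> uniq (s :: p) ->
    B y -> R (last s p) y -> ~ (f @` A) y ->
  exists g, matching (s |` A) B g.
Proof.
elim: p A f s => [|x p IH] A f s [finj fimg frel ffin] As /=.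
  move=> _ _ By Rsy nfy; exists (fun v => if v == s then y else f v).
  have fy v : A v -> f v <> y by move=> Av fv; apply: nfy; exists v.
  split=> [u v|v|v|].
  - rewrite !inE /= => -[->|Au] [->|Av] //; rewrite ?eqxx //.
    + by have [->//|_ E] := eqVneq v s; case: (fy v).
    + by have [->//|_ E] := eqVneq u s; case: (fy u).
    + have [E|_] := eqVneq u s; first by rewrite E in Au.
      have [E|_] := eqVneq v s; first by rewrite E in Av.
      by apply: finj; rewrite inE.
  - by move=> [->|Av]; rewrite ?eqxx //; case: ifP => // _; exact: fimg.
  - by move=> [->|Av]; rewrite ?eqxx //; case: eqVneq => [->//|_]; exact: frel.
  - apply: (@sub_finite_set _ _ (s |` [set v | A v /\ f v <> v])).
      move=> v [[->|Av]]; first by left.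
      by case: eqVneq => [->|_ ?]; [left|right].
    by rewrite finite_setU.
move=> /andP[/asboolP[Ax Rsx] xp] /andP[]; rewrite inE negb_or => /andP[sx sp].
move=> xpu By Ry nfy.
pose f1 v := if v == s then f x else f v.
pose A1 := [set v | v = s \/ A v /\ v <> x].
have A1E : x |` A1 = s |` A.
  apply/seteqP; split=> v /=; first by move=> [->|[->|[Av _]]]; by [right|left|right].
  move=> [->|Av]; first by right; left.
  by have [->|/eqP nx] := eqVneq v x; [left|right; right].
have f1A v : A v -> f1 v = f v.
  by rewrite /f1; case: eqVneq => // -> /As.
have f1s : f1 s = f x by rewrite /f1 eqxx.
have fA1 v : A1 v -> exists2 u, A u & f1 v = f u /\ (v = s -> u = x) /\ (v <> s -> u = v).
  move=> [->|[Av _]]; first by exists x.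
  by exists v => //; split; [exact: f1A|split=> // E; rewrite E in Av].
have := @IH A1 f1 x; rewrite A1E; apply=> //.
- split=> [u v|v|v|].
  + rewrite !inE => -[->|[Au ux]] [->|[Av vx]] //; rewrite ?f1s ?(f1A _ Au) ?(f1A _ Av).
    * by move/finj; rewrite !inE => /(_ Ax Av) E; case: vx.
    * by move/finj; rewrite !inE => /(_ Au Ax) E; case: ux.
    * by move/finj; rewrite !inE => /(_ Au Av).
  + by move=> [->|[Av _]]; rewrite ?f1s ?(f1A _ Av); exact: fimg.
  + by move=> [->|[Av _]]; rewrite ?f1s ?(f1A _ Av) //; exact: frel.
  + apply: (@sub_finite_set _ _ (s |` [set v | A v /\ f v <> v])).
      move=> v [[->|[Av _]]]; first by left.
      by rewrite (f1A _ Av); right.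
    by rewrite finite_setU.
- by move=> [E|[_ /(_ erefl)]//]; rewrite E eqxx in sx.
- move: xp xpu; case: {IH Ry} p sp => //= z p; rewrite inE negb_or => /andP[sz sp].
  move=> /andP[/asboolP[Az Rxz] zp] /andP[/[1!inE] /norP[xz xp] /andP[zp' pu]].
  have Hz v : v \in z :: p -> A v -> A1 v /\ f1 v = f v.
    move=> vp Av; split; last exact: f1A.
    right; split=> // E; rewrite E inE (negPf xz) /= in vp.
    by rewrite vp in xp.
  apply/andP; split; first by apply/asboolP; have [||? ->] := Hz z; rewrite ?mem_head.
  move: zp Hz {xz xp sz sp Rxz pu zp'}; elim: p z Az => //= v p IHp z Az.
  move=> /andP[/asboolP[Av Rzv] vp] Hz; apply/andP; split.
    by apply/asboolP; have [||? ->] := Hz v; rewrite ?inE ?eqxx ?orbT.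
  by apply: IHp => // u uvp; apply: Hz; rewrite inE uvp orbT.
- move=> [v /fA1[u Au [-> _]] E]; apply: nfy; by exists u.
Qed.

(* The augmenting-path step of Menger's theorem, for a set S linked within U
   to B: a linkage is encoded as an injection from U to B moving finitely many
   vertices, each to a neighbour, the paths being its orbits from S. Starting
   from the identity off S, the vertices of S are added one by one; a failure
   yields a set X of alternating-reachable vertices whose boundary is a
   separator smaller than S. *)
Lemma linkage U S B : (forall x, R x x) -> finite_set S -> S `<=` U ->
    U `\` S `<=` B ->
    (forall X, X `<=` U ->
       let W := (S `\` X) `|` ((neighbours X `&` B) `\` X) in
       finite_set W -> (fcard S <= fcard W)%N) ->
  exists f, matching U B f.
Proof.
move=> Rxx finS SU USB Hall.
have ext s A f : matching A B f -> U `\` S `<=` A -> A `<=` U -> S s -> ~ A s ->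
    exists g, matching (s |` A) B g.
  move=> /[dup] mf [finj fimg frel ffin] USA AU Ss As.
  (* [X] is what alternating steps reach from [s]. If no augmentation is possible, every neighbour
     of [X] in [B] is the partner of a vertex of [X] other than [s]. *)
  pose X := [set x | exists2 p, path (alternating A f) s p & last s p = x].
  have Xs : X s by exists [::].
  have XsA : X `\ s `<=` A.
    move=> x [[p + <-]] ns; case: (lastP p) ns => [[]//|q z _].
    by rewrite rcons_path last_rcons => /andP[_ /asboolP[]].
  have XU : X `<=` U.
    move=> x Xx; have [->|/eqP nxs] := eqVneq x s; first exact: SU.
    by apply: AU; apply: XsA; split.
  apply: contrapT => nog.
  have NX y : B y -> neighbours X y -> (f @` (X `\ s)) y.
    move=> By [x [p sp xE] Rxy]; rewrite -xE in Rxy.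
    have [[x' Ax' fx']|nfy] := pselect ((f @` A) y).
      exists x' => //; split; last by move=> /= E; rewrite E in Ax'.
      exists (rcons p x'); last by rewrite last_rcons.
      by rewrite rcons_path sp; apply/asboolP; rewrite fx'.
    case: nog; move: Rxy; case: (shortenP sp) => p' sp' up' _ Rxy.
    exact: alternating_augment mf As sp' up' By Rxy nfy.
  set Y := (neighbours X `&` B) `\` X.
  (* [X] may be infinite, so counting is confined to the finite set [M], outside which [f] fixes the
     vertices of [A]. *)
  pose Mv := [set x | A x /\ f x <> x].
  pose M := (Mv `|` f @` Mv) `|` S.
  have finM : finite_set M by rewrite !finite_setU; do !split=> //; exact: finite_image.
  have Mf v : A v -> M (f v) -> M v.
    move=> Av; have [->//|/eqP fv] := eqVneq (f v) v; first by left; left.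
  have YM : Y `<=` M.
    move=> y [[Ny By] nXy]; have [x [Xx sx] fx] := NX _ By Ny.
    left; right; exists x => //; split; first exact: XsA.
    by rewrite fx => E; rewrite E in nXy.
  have finI V : V `<=` M -> finite_set V by move=> VM; exact: sub_finite_set finM.
  pose X1 := (X `\` S) `&` M.
  have finX1 : finite_set X1 by apply: finI => y [].
  have finY : finite_set Y by exact: finI.
  have finXs : finite_set ((X `\ s) `&` M) by apply: finI => y [].
  (* The images under [f] cover the outer boundary [Y] and also [X1], whose vertices are neighbours
     of [X] because [R] is reflexive. *)
  have le1 : (fcard Y + fcard X1 <= fcard ((X `\ s) `&` M))%N.
    rewrite -fcardU //; last by rewrite -subset0 => y [[_ nX] [[/nX]]].
    apply: leq_trans (fcard_image f finXs); apply: fcard_sub.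
      exact: finite_image.
    move=> y y01; have [[By Ny] My] : (B y /\ neighbours X y) /\ M y.
      case: y01 => [[[]]|[[Xy nSy] My]]; first by move=> *; split=> //; apply: YM.
      by split=> //; split; [apply: USB; split=> //; exact: XU|exists y].
    have [x Xx fx] := NX _ By Ny; exists x => //; split=> //.
    by apply: Mf; rewrite ?fx //; exact: XsA.
  have finSX : finite_set (S `&` X) by apply: finI => y []; right.
  have finSD : finite_set (S `\` X) by apply: finI => y []; right.
  (* Strict because [s] lies in both [S] and [X] but is left out on the left. *)
  have le2 : (fcard ((X `\ s) `&` M) < fcard (S `&` X) + fcard X1)%N.
    rewrite -fcardU //; last by rewrite -subset0 => y [[Sy _] [[_]]].
    rewrite -addn1 -(fcard1 s) -fcardU //; last first.
      by rewrite -subset0 => y [[[_ ns] _]].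
    apply: fcard_sub; first by rewrite finite_setU.
    move=> y [[[Xy ns] My]|->]; last by left.
    by have [Sy|nSy] := pselect (S y); [left|right].
  have le3 : (fcard (S `&` X) + fcard (S `\` X) <= fcard S)%N.
    rewrite -fcardU //; last by rewrite -subset0 => y [[_ Xy] [_]].
    by apply: fcard_sub => // y [[]|[]].
  have finW : finite_set ((S `\` X) `|` Y) by rewrite finite_setU.
  have := leq_trans (Hall X XU finW) (fcardU_le finSD finY); lia.
have /finite_seqP[l SE] := finS.
suff ext_seq (l' : seq T) : [set` l'] `<=` S ->
    exists f, matching ((U `\` S) `|` [set` l']) B f.
  have [|f mf] := ext_seq l; first by rewrite SE.
  exists f; suff <- : U `\` S `|` [set` l] = U by [].
  rewrite -SE; apply/seteqP; split=> x; first by case=> [[]//|/SU].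
  by move=> Ux; have [|] := pselect (S x); [right|left].
elim: l' => [_|s l' IH lS].
  exists id; split=> // [x [[Ux Sx]|//]|]; first by apply: USB.
  by apply: (@sub_finite_set _ _ set0) => // x [].
have [|f mf] := IH; first by move=> x xl; apply: lS; rewrite /= inE xl orbT.
have Ss : S s by apply: lS; rewrite /= mem_head.
set A := U `\` S `|` [set` l'] in mf.
have -> : U `\` S `|` [set` s :: l'] = s |` A.
  apply/seteqP; split=> x /=; rewrite inE.
    by move=> [Ux|/orP[/eqP->|xl]]; [right; left|left|right; right].
  by move=> [->|[Ux|xl]]; [right; rewrite eqxx|left|right; rewrite xl orbT].
have [As|As] := pselect (A s).
  by exists f; have -> : s |` A = A; [apply/seteqP; split=> x; [case=> [->//|//]|right]|].
apply: ext mf _ _ Ss As; first by left.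
move=> x [[]//|xl]; apply: SU; apply: lS; by rewrite /= inE xl orbT.
Qed.

End Linkage.

(** * Vertices dominating an end *)

Lemma finite_inj_image (T U : Type) (A : set T) (f : T -> U) :
  {in A &, injective f} -> finite_set (f @` A) -> finite_set A.
Proof. by move=> /inj_card_eq fA; rewrite (eq_finite_set fA). Qed.

Lemma finite_injP (T U : Type) (A : set T) (B : set U) (f : T -> U) :
    (forall x, A x -> B (f x)) ->
    (forall x y, A x -> A y -> f x = f y -> x = y) ->
  finite_set B -> finite_set A.
Proof.
move=> AB finj finB; apply: (@finite_inj_image _ _ A f).
  by move=> x y; rewrite !inE; exact: finj.
by apply: sub_finite_set finB => _ [x Ax <-]; exact: AB.
Qed.

Lemma infinite_nat_inj (T : Type) (x : nat -> T) : injective x ->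
  infinite_set (range x).
Proof.
move=> xinj fin; apply: infinite_nat; apply: finite_inj_image fin.
by move=> i j _ _; exact: xinj.
Qed.

(** Of infinitely many paths disjoint except at [v], only finitely many meet a given finite set.
    Conversely, a neighbour of [v] in the home of everything used so far starts one more path. *)
Lemma dominatesP (G : sgraph) (r : ray G) (v : G) :
  dominates v [set r' | ray_equiv r r'] <->
  forall F, finite_set F -> exists2 u, home r F u & adj v u.
Proof.
split=> [[r0 /ray_equivP rr0 [P [infP Ppath trP]]] F finF|H].
  have [n0 r0F] := rr0 F finF.
  (* Adding the initial part of [r0] forces the path to end on the tail of [r0] inside
     [home r F]. *)
  pose F' := F `|` (r0 @` `I_n0).
  have finF' : finite_set F' by rewrite finite_setU; split=> //; exact: finite_image.
  have [p [Pp pn pF]] : exists p, [/\ P p, p <> [::] & forall z, z \in p -> ~ F' z].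
    apply: contrapT => nop.
    have /choice[h hP] : forall p : seq G, exists z,
        P p /\ p <> [::] -> z \in p /\ F' z.
      move=> p; have [[z [zp Fz]]|nz] := pselect (exists z, z \in p /\ F' z).
        by exists z.
      exists v => -[Pp pn]; case: nop; exists p; split=> // z zp Fz.
      by apply: nz; exists z.
    apply: (infinite_setD infP (finite_set1 [::])).
    apply: (@finite_injP _ _ _ F' h) finF'; first by move=> p /hP[].
    move=> p q /[dup] Pp [? _] /[dup] Pq [? _] hpq; apply: trP => //.
    by exists (h p); split; [case: (hP p Pp)|rewrite hpq; case: (hP q Pq)].
  have [+ + [i _ ri]] := Ppath _ Pp; case: p Pp pn pF ri => // u p Pp _ pF ri.
  move=> /= /andP[vu up] _; exists u => //.
  have F'i : ~ F' (r0 i) by rewrite ri /=; apply: pF; exact: mem_last.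
  have : home r F (r0 i).
    apply: r0F; rewrite leqNgt; apply/negP => ltin; apply: F'i; right.
    by exists i.
  move=> /linked_home; apply; apply: linked_sym; exists p; split=> // z zp.
  by move=> Fz; apply: (pF z) => //; left.
have [|x [xP xd]] := @disjoint_seq (seq G) G
    (fun p => path_to_ray v r p /\ p <> [::]) (fun p => [set` p]).
  move=> F finF.
  have [|u [n nu] vu] := H (v |` F); first by rewrite finite_setU.
  have [p [up pr pF]] := linked_sym (nu n (leqnn n)).
  move: pr pF; case: (shortenP up) => p' up' p'u p'p pr pF.
  have p'F z : z \in u :: p' -> ~ (v |` F) z.
    rewrite inE => zp; apply: pF; rewrite inE; case/orP: zp => [->//|/p'p zp].
    by apply/orP; right.
  exists (u :: p'); split.
  - split=> //; split; [by rewrite /= vu|rewrite cons_uniq p'u andbT|by exists n].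
    by apply/negP => /p'F; apply; left.
  - exact: finite_seq.
  - by rewrite -subset0 => z [/p'F + Fz]; apply; right.
have xdisj i j z : z \in x i -> z \in x j -> i = j.
  move=> zi zj; case: (ltngtP i j) => // ij; suff : set0 z by [].
    by rewrite -(xd _ _ ij).
  by rewrite -(xd _ _ ij).
exists r; first by apply/ray_equivP => F /(ray_home r).
exists (range x); split.
- apply: infinite_nat_inj => i j xij.
  case E : (x i) (xP i) => [|z p] [_ //] _.
  by apply: (@xdisj _ _ z); rewrite -?xij E mem_head.
- by move=> _ [n _ <-]; have [] := xP n.
- by move=> _ _ [i _ <-] [j _ <-] [z [/= zi /(xdisj _ _ _ zi) ->]].
Qed.

(** * Minimum separators between a finite set and the end *)

Section Separators.
Variables (G : sgraph) (r : ray G).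
Let w : set (ray G) := [set r' | ray_equiv r r'].
Let D : set G := [set v | dominates v w].
Implicit Types (W S Z : set G) (x y z v : G).

(* The last vertex outside home (D `|` S) of a path from z to the end lies
   in S. *)
Lemma last_exit S W W' z : finite_set (D `|` S) -> finite_set (D `|` W') ->
    ~ home r (D `|` S) z -> home r (D `|` W') z ->
    W `&` (home r (D `|` S) `|` S) `<=` W' -> finite_set (D `|` W) ->
  exists2 u, S u & home r (D `|` W) u.
Proof.
move=> finS finW' nz [n nW'] WW' finW.
have [n1 n1S] := ray_home r finS; have [n2 n2W] := ray_home r finW.
pose m := (n + (n1 + n2))%N.
have rS : home r (D `|` S) (r m) by apply: n1S; lia.
have rW : home r (D `|` W) (r m) by apply: n2W; lia.
have {nW'} : linked (D `|` W') (r m) z by apply: nW'; lia.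
pose found := exists2 u, S u & home r (D `|` W) u.
move=> rz; suff [[]//|//] : (home r (D `|` S) z /\ home r (D `|` W) z) \/ found.
move: rz; apply: (@linked_ind _ _ (fun x =>
  (home r (D `|` S) x /\ home r (D `|` W) x) \/ found)); first by left.
move=> x y [[xS xW]|?] xy _ yW'; last by right.
have Dy : ~ D y by move=> Dy; apply: yW'; left.
have [Sy|Sy] := pselect (S y).
  right; exists y => //; apply: home_step xW xy _ => -[//|Wy].
  by apply: yW'; right; apply: WW'; split=> //; right.
have yS : home r (D `|` S) y by apply: home_step xS xy _ => -[].
left; split=> //; apply: home_step xW xy _ => -[//|Wy].
by apply: yW'; right; apply: WW'; split=> //; left.
Qed.

(** No vertex of [Z] dominates the end, so a finite set cuts its neighbours off from the end. The
    union of these sets works, after removal of [Z] and [D]. *)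
Lemma undominated_separator Z : finite_set D -> finite_set Z -> Z `&` D = set0 ->
  exists W, [/\ finite_set W, W `&` (Z `|` D) = set0 &
                Z `&` home r (D `|` W) = set0].
Proof.
move=> finD finZ ZD.
have /choice[Wf WfP] : forall s, exists W, Z s ->
    finite_set W /\ forall u, home r W u -> ~~ adj s u.
  move=> s; have [Zs|nZ] := pselect (Z s); last by exists set0.
  have nDs : ~ D s by move=> Ds; suff : set0 s by []; rewrite -ZD.
  have /existsNP[W /not_implyP[finW nW]] : ~ forall F, finite_set F ->
      exists2 u, home r F u & adj s u by move=> /dominatesP.
  exists W => _; split=> // u Wu; apply/negP => su; apply: nW.
  by exists u.
pose W := (\bigcup_(s in Z) Wf s) `\` (Z `|` D).
have finW0 : finite_set (\bigcup_(s in Z) Wf s).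
  by apply: bigcup_finite => // s /WfP[].
have finW : finite_set W by exact: finite_setD.
exists W; split=> //; first by rewrite -subset0 => x [[]].
rewrite -subset0 => z [Zz Wz].
pose E := Z `|` D `|` W.
have [u [s Zs [Eu su]]] : exists u, exists2 s, Z s & home r E u /\ adj s u.
  have finE : finite_set E by rewrite !finite_setU.
  have [n1 n1E] := ray_home r finE; have [n nz] := Wz.
  have {nz} : linked (D `|` W) (r (n + n1)) z by apply: nz; lia.
  have {n1E} := n1E (n + n1)%N (leq_addl _ _) .
  move: (r _) => x xE xz.
  pose found := exists u, exists2 s, Z s & home r E u /\ adj s u.
  suff [/homeN|//] : home r E z \/ found by case; left; left.
  move: xz; apply: (@linked_ind _ _ (fun x => home r E x \/ found)); first by left.
  move=> u v [Eu|?] uv _ nDv; last by right.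
  have [Zv|Zv] := pselect (Z v).
    by right; exists u, v => //; rewrite adj_sym.
  left; apply: home_step Eu uv _ => -[[//|Dv]|Wv]; apply: nDv; by [left|right].
have [_ /(_ u) nsu] := WfP _ Zs; move: (su); apply/negP/nsu.
apply: home_sub Eu => y Wy; have [[|]|nZD] := pselect ((Z `|` D) y).
- by left; left.
- by left; right.
- by right; split=> //; exists s.
Qed.

(** [S] has minimum size among the sets that cut [S] off from the end in [G - D] without using
    vertices in front of [S]. This is the Menger condition for linking all of [S] to a later
    separator. *)
Definition tight S := forall W, finite_set W ->
  W `<=` home r (D `|` S) `|` S -> S `&` home r (D `|` W) = set0 ->
  (fcard S <= fcard W)%N.

Definition separator Z S := [/\ finite_set S, S `<=` home r (D `|` Z) &
  Z `&` home r (D `|` S) = set0].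

(** A smallest separator is tight: a set on its end side that cuts it off from the end also cuts [Z]
    off, hence is no smaller. *)
Lemma exists_tight Z : finite_set D -> finite_set Z -> Z `&` D = set0 ->
  exists2 S, separator Z S & tight S.
Proof.
move=> finD finZ ZD.
have finDZ : finite_set (D `|` Z) by rewrite finite_setU.
have [S0 [finS0 S0ZD S0sep]] := undominated_separator finD finZ ZD.
(* Only the vertices of [S0] on the end side of [Z] are kept; by [last_exit] they still separate. *)
pose S1 := S0 `&` home r (D `|` Z).
have finS1 : finite_set S1 by apply: sub_finite_set finS0 => x [].
have exK : exists n, `[< exists2 S, separator Z S & fcard S = n >].
  exists (fcard S1); apply/asboolP; exists S1 => //; split=> //; first by move=> x [].
  rewrite -subset0 => z [Zz zS1].
  have [||||||u Zu uS0] := @last_exit Z S0 S1 z => //; rewrite ?finite_setU //.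
  - by move=> /homeN; apply; right.
  - move=> x [S0x [Zx|Zx]]; first by split.
    by suff : set0 x by []; rewrite -S0ZD; split=> //; left.
  - by suff : set0 u by []; rewrite -S0sep.
have [n /asboolP[S [finS SZ Ssep] Sn] nmin] := ex_minnP exK.
exists S => // W finW WS Wsep; rewrite Sn; apply: nmin; apply/asboolP.
exists W => //; split=> //.
  move=> x /WS [|/SZ//]; apply: home_disjoint_sub; rewrite -subset0 => y [yS].
  move=> [Dy|Zy]; first by apply: (homeN yS); left.
  by suff : set0 y by []; rewrite -Ssep.
rewrite -subset0 => z [Zz zW].
have [||||||u Su uW] := @last_exit S W W z => //; rewrite ?finite_setU //.
- by move=> zS; suff : set0 z by []; rewrite -Ssep.
- by suff : set0 u by []; rewrite -Wsep.
Qed.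

(* Passing along the tower S 0, S 1, ... towards the end, layer (S n) (S n.+1)
   is what lies between S n (included) and S n.+1 (excluded). *)
Definition side S : set G := home r (D `|` S) `|` S.
Definition layer S S' : set G := side S `\` side S'.
(** Staying is allowed so that a vertex on no path of the linkage can be matched to itself. *)
Definition stay_or_move x y : Prop := y = x \/ adj x y.

Lemma separator_home Z S : separator Z S ->
  home r (D `|` S) `<=` home r (D `|` Z).
Proof.
move=> [_ SZ ZS]; apply: home_disjoint_sub; rewrite -subset0 => y [yS [Dy|Zy]].
  by apply: (homeN yS); left.
by rewrite -ZS.
Qed.

Lemma separator_side Z S : separator Z S -> side S `<=` home r (D `|` Z).
Proof. by move=> ZS x [/(separator_home ZS)//|Sx]; have [_ + _] := ZS; exact. Qed.

Lemma sub_layer Z S : separator Z S -> Z `<=` layer Z S.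
Proof.
move=> ZS x Zx; split; first by right.
by move=> /(separator_side ZS)/homeN; apply; right.
Qed.

(** Tightness gives the hypothesis of [linkage]: if the set [W] did not cut [S] off, a walk from [S]
    towards the end avoiding [D] and [W] would always be in [X] or in front of [S], and never get
    beyond [S']. *)
Lemma tight_linkage S S' : finite_set D -> finite_set S ->
    tight S -> separator S S' ->
  exists f, matching stay_or_move (layer S S') (layer S S' `\` S `|` S') f.
Proof.
move=> finD finS tightS SS'; have [finS' S'S SS'0] := SS'.
apply: (@linkage _ _ _ S) => //.
- by move=> x; left.
- exact: sub_layer SS'.
move=> X XU W finW; apply: tightS => //.
  by move=> x [[Sx _]|[[_ [[[sx _] _]|/S'S S'x]] _]]; [right|exact: sx|left].
rewrite -subset0 => s [Ss sW].
have nWs : ~ W s by move=> Ws; apply: (homeN sW); right.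
have Xs : X s by apply: contrapT => nXs; apply: nWs; left.
have finDS' : finite_set (D `|` S') by rewrite finite_setU.
have [n1 n1S'] := ray_home r finDS'; have [n sn] := sW.
have rS' := n1S' (n + n1)%N (leq_addl _ _).
have := linked_sym (sn (n + n1)%N (leq_addr _ _)).
move: (r _) rS' => y yS' sy.
suff [/XU[_]|] : X y \/ ~ side S y.
- by apply; left.
- by apply; left; exact: separator_home yS'.
have WX x : S x -> ~ (D `|` W) x -> X x.
  by move=> Sx nx; apply: contrapT => nX; apply: nx; right; left.
move: sy; apply: (@linked_ind _ _ (fun x => X x \/ ~ side S x)); first by left.
move=> u v [Xu|nu] uv nuW nvW.
- have [vS|] := pselect (side S v); last by right.
  left; apply: contrapT => nXv; have [Su nSu] := XU _ Xu.
  have [Sv|nSv] := pselect (S v); first by apply: nXv; exact: WX.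
  apply: nvW; right; right; split=> //; split; first by exists u => //; right.
  have [[vS'|S'v]|nvS'] := pselect (side S' v); last by left.
    case: (nSu); left; apply: home_step vS' _ _; first by rewrite adj_sym.
    by move=> [Du|S'u]; [apply: nuW; left|apply: nSu; right].
  by right.
- have [Sv|nSv] := pselect (S v); first by left; exact: WX.
  right=> -[vS|//]; apply: nu; have [Su|nSu] := pselect (S u); first by right.
  left; apply: home_step vS _ _; first by rewrite adj_sym.
  by move=> [Du|//]; apply: nuW; left.
Qed.

Lemma exists_tower S0 : finite_set D -> finite_set S0 -> S0 `&` D = set0 ->
    tight S0 ->
  exists (S : nat -> set G) (f : nat -> G -> G), S 0%N = S0 /\ forall n,
    separator (S n) (S n.+1) /\
    matching stay_or_move (layer (S n) (S n.+1))
      (layer (S n) (S n.+1) `\` S n `|` S n.+1) (f n).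
Proof.
move=> finD finS0 S0D tS0.
pose stage S := [/\ finite_set S, S `&` D = set0 & tight S].
have /choice[c cP] : forall S, exists p : set G * (G -> G), stage S ->
    [/\ stage p.1, separator S p.1 & matching stay_or_move (layer S p.1)
      (layer S p.1 `\` S `|` p.1) p.2].
  move=> S; have [[finS SD tS]|nS] := pselect (stage S); last by exists (set0, id).
  have [S' SS' tS'] := exists_tight finD finS SD.
  have [f mf] := tight_linkage finD finS tS SS'.
  exists (S', f) => _; split=> //; have [finS' S'S _] := SS'; split=> //.
  by rewrite -subset0 => x [/S'S/homeN nx Dx]; apply: nx; left.
pose S n := iter n (fun S => (c S).1) S0.
have stageS n : stage (S n) by elim: n => [|n /cP[]].
exists S, (fun n => (c (S n)).2); split=> // n; by have [] := cP _ (stageS n).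
Qed.

(** * Disjoint rays through an infinite tower of separators *)

Section Tower.
Variables (S : nat -> set G) (f : nat -> G -> G).
Hypothesis sepS : forall n, separator (S n) (S n.+1).
Let L n := layer (S n) (S n.+1).
Hypothesis matchS : forall n,
  matching stay_or_move (L n) (L n `\` S n `|` S n.+1) (f n).

Lemma tower_side i j : (i < j)%N -> side (S j) `<=` home r (D `|` S i).
Proof.
elim: j => // j IH; rewrite ltnS leq_eqVlt => /predU1P[->|/IH ij].
  exact: separator_side.
by move=> x /(separator_side (sepS j)) xj; apply: ij; left.
Qed.

Lemma tower_side_le i j : (i <= j)%N -> side (S j) `<=` side (S i).
Proof.
by rewrite leq_eqVlt => /predU1P[->//|/tower_side ij x /ij]; left.
Qed.

Lemma tower_layer_inj i j x : L i x -> L j x -> i = j.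
Proof.
have H i' j' : (i' < j')%N -> L i' x -> ~ L j' x.
  by move=> ij [_ nx] [/(tower_side_le ij)].
move=> Li Lj; case: (ltngtP i j) => // ij; first by case: (H _ _ ij).
by case: (H _ _ ij).
Qed.

(* The layers are disjoint, so the matchings f n glue to one injection whose
   image misses S 0. *)
Let next x : G := if pselect (exists i, L i x) is left iP
  then f (projT1 (cid iP)) x else x.

Lemma nextE i x : L i x -> next x = f i x.
Proof.
rewrite /next => Lx; case: pselect => [iP|[]]; last by exists i.
by case: cid => j /= Lj; rewrite (tower_layer_inj Lj Lx).
Qed.

Lemma tower_S i : S i `<=` L i.
Proof. by apply: sub_layer. Qed.

Lemma next_layer i x : L i x -> L i (next x) /\ ~ S i (next x) \/ S i.+1 (next x).
Proof.
move=> Lx; rewrite (nextE Lx); have [_ + _ _] := matchS i.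
by move=> /(_ _ Lx)[[]|]; [left|right].
Qed.

(** Images of distinct layers could collide only in the first separator of a layer, which is reached
    from the layer before but never from within. *)
Lemma next_inj i j x y : L i x -> L j y -> next x = next y -> x = y.
Proof.
move=> Lx Ly E; suff ij : i = j.
  subst j; have [+ _ _ _] := matchS i; apply; rewrite ?inE //.
  by rewrite -(nextE Lx) -(nextE Ly).
have := next_layer Lx; have := next_layer Ly; rewrite E.
move=> [[Lj nSj]|Sj] [[Li nSi]|Si].
- exact: tower_layer_inj Li Lj.
- by have ij := tower_layer_inj (tower_S Si) Lj; rewrite -ij in nSj.
- by have ij := tower_layer_inj (tower_S Sj) Li; rewrite -ij in nSi.
- by have [] := tower_layer_inj (tower_S Si) (tower_S Sj).
Qed.

Lemma next_S0 i x : L i x -> ~ S 0%N (next x).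
Proof.
move=> /next_layer[[Li nSi]|Si] S0; have L0 := tower_S S0.
  by have i0 := tower_layer_inj Li L0; rewrite i0 in nSi.
by have := tower_layer_inj (tower_S Si) L0.
Qed.

Section Orbit.
Variable s : G.
Hypothesis Ss : S 0%N s.

Lemma orbit_layer n : exists i, L i (iter n next s).
Proof.
elim: n => [|n [i]]; first by exists 0%N; exact: tower_S.
by move=> /next_layer[[Li _]|/tower_S]; [exists i|exists i.+1].
Qed.

Lemma orbit_side_step j n :
  side (S j) (iter n next s) -> side (S j) (iter n.+1 next s).
Proof.
move=> xj /=; have [i Li] := orbit_layer n.
have ji : (j <= i)%N.
  by rewrite leqNgt; apply/negP => /tower_side_le ij; have [_] := Li; apply; exact: ij.
apply: (tower_side_le ji); have [[[]]//|S1] := next_layer Li.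
by apply: (tower_side_le (leqnSn i)); right.
Qed.

End Orbit.

(** After cancelling [next] on both sides, an exponent that runs out first would put an image of
    [next] in [S 0]. *)
Lemma orbit_inj s s' a b : S 0%N s -> S 0%N s' ->
  iter a next s = iter b next s' -> s = s' /\ a = b.
Proof.
move=> Ss Ss'; elim: a b => [|a IH] [|b] //=.
- by move=> E; have [i Li] := orbit_layer Ss' b; case: (next_S0 Li); rewrite -E.
- by move=> E; have [i Li] := orbit_layer Ss a; case: (next_S0 Li); rewrite E.
have [i Li] := orbit_layer Ss a; have [j Lj] := orbit_layer Ss' b.
by move=> /(next_inj Li Lj)/IH[-> ->].
Qed.

Lemma orbit_move s n : S 0%N s -> iter n.+1 next s <> iter n next s.
Proof. by move=> Ss /(orbit_inj Ss Ss)[_]; lia. Qed.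

Lemma orbit_adj s n : S 0%N s -> adj (iter n next s) (iter n.+1 next s).
Proof.
move=> Ss; have [i Li] := orbit_layer Ss n; have [_ _ + _] := matchS i.
by move=> /(_ _ Li); rewrite -(nextE Li) => -[/(orbit_move Ss)|].
Qed.

(** An orbit that never left layer [j] would yield infinitely many vertices moved by [f j], while a
    matching moves only finitely many. *)
Lemma orbit_side s j : S 0%N s ->
  exists n, forall m, (n <= m)%N -> side (S j) (iter m next s).
Proof.
move=> Ss; have mono j' n : side (S j') (iter n next s) ->
    forall m, (n <= m)%N -> side (S j') (iter m next s).
  move=> xn m /subnKC <-; elim: (m - n)%N => [|d IH]; first by rewrite addn0.
  by rewrite addnS; exact: orbit_side_step.
elim: j => [|j [n nj]]; first by exists 0%N; apply: mono; right.
suff [m xm] : exists m, side (S j.+1) (iter m next s) by exists m; exact: mono.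
apply: contrapT => nox; have Lm m : (n <= m)%N -> L j (iter m next s).
  by move=> nm; split; [exact: nj|move=> xm; apply: nox; exists m].
have [_ _ _ fin] := matchS j.
apply: (@infinite_nat_inj _ (fun m => iter (n + m) next s)).
  by move=> a b /(orbit_inj Ss Ss)[_ /addnI].
apply: sub_finite_set fin => _ [m _ <-]; split; first by apply: Lm; exact: leq_addr.
by rewrite -nextE; [exact: (@orbit_move _ (n + m))|apply: Lm; exact: leq_addr].
Qed.

(** A vertex beyond every [S j] would be linked, outside [D] and [S 0], to a vertex [y] of an orbit.
    Being beyond every [S j] spreads along the walk, so [y] could lie in no layer. *)
Lemma tower_escape x : S 0%N !=set0 -> exists j, ~ home r (D `|` S j) x.
Proof.
move=> [s Ss]; apply: contrapT => /forallNP/= xj.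
have {xj}xj j : home r (D `|` S j) x by apply: contrapT; exact: xj.
have [n /(_ n (leqnn n)) n1] := orbit_side 1 Ss.
have [i Li] := orbit_layer Ss n.
have := home_linked (xj 0%N) (tower_side (ltn0Sn 0) n1).
move: (iter n next s) Li => y [_ ny] xy.
suff /(_ i.+1) yj : forall j, home r (D `|` S j) y by apply: ny; left.
move: xy; apply: (@linked_ind _ _ (fun y => forall j, home r (D `|` S j) y)) => //.
(* The step is made with [S j.+1]: the next vertex may lie on that separator, which is still beyond
   [S j]. *)
move=> u v uj uv _ nv j; apply: (tower_side (ltnSn j)).
have [Sv|nSv] := pselect (S j.+1 v); first by right.
by left; apply: home_step (uj _) uv _ => -[Dv|//]; apply: nv; left.
Qed.

Lemma tower_home F : S 0%N !=set0 -> finite_set F ->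
  exists j, home r (D `|` S j) `<=` home r F.
Proof.
move=> S0 /finite_seqP[l ->].
suff [j jl] : exists j, forall x, x \in l -> ~ home r (D `|` S j) x.
  by exists j; apply: home_disjoint_sub; rewrite -subset0 => x [? /jl].
elim: l => [|x l [j jl]]; first by exists 0%N.
have [j' j'x] := tower_escape x S0.
have H a b y : (a <= b)%N -> home r (D `|` S b) y -> home r (D `|` S a) y.
  by rewrite leq_eqVlt => /predU1P[->//|/tower_side ab yb]; apply: ab; left.
exists (maxn j j') => y; rewrite inE => /predU1P[->|/jl yj].
  by move=> /(H _ _ _ (leq_maxr _ _)).
by move=> /(H _ _ _ (leq_maxl _ _)).
Qed.

Lemma tower_rays : exists g : G -> ray G, (forall s, S 0%N s -> w (g s)) /\
  (forall s s' a b, S 0%N s -> S 0%N s' -> g s a = g s' b -> s = s').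
Proof.
have /choice[g gP] : forall s, exists g : ray G, S 0%N s ->
    forall n, g n = iter n next s.
  move=> s; have [Ss|nS] := pselect (S 0%N s); last by exists r.
  have inj : injective (fun n => iter n next s).
    by move=> a b /(orbit_inj Ss Ss)[].
  by exists (Ray inj (fun n => orbit_adj n Ss)).
exists g; split; last first.
  by move=> s s' a b Ss Ss'; rewrite !gP // => /(orbit_inj Ss Ss')[].
move=> s Ss; apply/ray_equivP => F finF.
have [|j jF] := @tower_home F _ finF; first by exists s.
have [n nj] := orbit_side j.+1 Ss; exists n => m nm; apply: jF.
by rewrite gP //; apply: (tower_side (ltnSn j)); exact: nj.
Qed.

End Tower.

(** A tight separator with at least [n] vertices would start a tower carrying [n] disjoint rays of
    the end. *)
Lemma end_separator Z n : finite_set D -> finite_set Z ->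
    (forall g : nat -> ray G, (forall i, (i < n)%N -> w (g i)) ->
      ~ (forall i j a b, (i < n)%N -> (j < n)%N -> g i a = g j b -> i = j)) ->
  exists S, [/\ finite_set S, (fcard S < n)%N, S `&` (Z `|` D) = set0 &
    Z `&` home r (D `|` S) = set0].
Proof.
move=> finD finZ noray.
have finZD : finite_set (Z `\` D) by exact: finite_setD.
have [|S [finS SZ ZS] tS] := exists_tight finD finZD.
  by rewrite -subset0 => x [[]].
have SN x : S x -> ~ (D `|` (Z `\` D)) x by move=> /SZ/homeN.
have SD0 : S `&` D = set0 by rewrite -subset0 => x [/SN nx Dx]; apply: nx; left.
exists S; split=> //; last 2 first.
- rewrite -subset0 => x [/SN nx [Zx|Dx]]; apply: nx; last by left.
  by have [Dx|nDx] := pselect (D x); [left|right].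
- rewrite -subset0 => x [Zx xS]; rewrite -ZS; split=> //; split=> // Dx.
  by apply: (homeN xS); left.
have [T [f [TS /all_and2[sepT matchT]]]] := exists_tower finD finS SD0 tS.
have [g [gw gdisj]] := tower_rays sepT matchT.
rewrite TS in gw gdisj.
rewrite ltnNge; apply/negP => nS.
pose s i := nth (r 0) (fset_set S) i.
have sS i : (i < n)%N -> S (s i).
  move=> ni; have : s i \in fset_set S by apply: mem_nth; exact: leq_trans nS.
  by rewrite in_fset_set // inE.
apply: (noray (g \o s)); first by move=> i /sS /gw.
move=> i j a b ni nj /gdisj -/(_ (sS _ ni) (sS _ nj))/eqP.
by rewrite nth_uniq ?fset_uniq => [/eqP|||]//; exact: leq_trans nS.
Qed.

End Separators.

(** * Degree and domination as extended integers *)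

Lemma fcard_II (T : choiceType) (A : set T) : finite_set A -> A #= `I_(fcard A).
Proof. by move=> /[dup] finA [n An]; rewrite /fcard (card_fset_set An). Qed.

Lemma card_ltE (T U : choiceType) (A : set T) (B : set U) :
  finite_set A -> finite_set B -> card_lt A B = (fcard A < fcard B)%N.
Proof.
move=> finA finB; rewrite /card_lt (card_le_eql (fcard_II finA)).
rewrite (card_le_eqr (fcard_II finB)) card_le_II ltn_neqAle andbC; congr andb.
by congr negb; apply/fcard_eq/eqP.
Qed.

Lemma card_lt_II (T : choiceType) (A : set T) k :
  card_lt A `I_k <-> finite_set A /\ (fcard A < k)%N.
Proof.
have fk : fcard `I_k = k by exact: card_fset_set.
split=> [/[dup] /andP[/card_le_finite finA _]|[finA Ak]]; last first.
  by rewrite card_ltE ?fk //; exact: finite_II.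
have {}finA := finA (finite_II k); rewrite card_ltE ?fk //; exact: finite_II.
Qed.

Lemma ecard_fin (T : Type) (A : set T) m : A #= `I_m -> ecard A = (Posz m)%:E%E.
Proof.
move=> Am; rewrite /ecard; case: pselect => [finA|[]]; last by exists m.
case: cid => m' /= Am'; congr (Posz _)%:E%E.
by apply/card_eq_II; apply: card_eq_trans Am; rewrite card_eq_sym.
Qed.

Lemma ecard_infty (T : Type) (A : set T) : infinite_set A -> ecard A = +oo%E.
Proof. by move=> infA; rewrite /ecard; case: pselect. Qed.

Lemma lee_posz m n : ((Posz m)%:E <= (Posz n)%:E)%E = (m <= n)%N.
Proof. by rewrite lee_fin lez_nat. Qed.

Definition disjoint_family (G : sgraph) (w : set (ray G)) n (g : nat -> ray G) :=
  (forall i, (i < n)%N -> w (g i)) /\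
  (forall i j a b, (i < n)%N -> (j < n)%N -> g i a = g j b -> i = j).

Lemma ecard_disjoint_family (G : sgraph) (w : set (ray G)) n (F : set (ray G)) :
    F `<=` w -> disjoint_rays F -> w !=set0 -> ((Posz n)%:E <= ecard F)%E ->
  exists g, disjoint_family w n g.
Proof.
move=> Fw Fdisj [r0 _].
have famI g : (forall i, (i < n)%N -> F (g i)) ->
    (forall i j, (i < n)%N -> (j < n)%N -> g i = g j -> i = j) ->
    exists g, disjoint_family w n g.
  move=> gF ginj; exists g; split=> [i ni|i j a b ni nj E]; first exact/Fw/gF.
  apply: ginj => //; apply: Fdisj; [exact: gF|exact: gF|].
  by exists (g i a); split; [exists a|exists b].
have [[m Fm]|infF] := pselect (finite_set F).
  rewrite (ecard_fin Fm) lee_posz => nm.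
  have /card_set_bijP[h [_ _ hsurj]] := Fm.
  have /choice[g gP] : forall i, exists x, (i < m)%N -> F x /\ h x = i.
    move=> i; case: (ltnP i m) => [/hsurj[x Fx hx]|_]; last by exists r0.
    by exists x.
  apply: (famI g) => [i ni|i j ni nj gij].
    by have [] := gP i (leq_trans ni nm).
  have [_ <-] := gP i (leq_trans ni nm); have [_ <-] := gP j (leq_trans nj nm).
  by rewrite gij.
move=> _; have [|g [gF gd]] := @disjoint_seq _ _ F (fun x => [set x]).
  move=> F' finF'; have [x [Fx nF'x]] := infinite_setN0 (infinite_setD infF finF').
  exists x; split=> //.
  by rewrite -subset0 => _ [-> ].
apply: (famI g) => // i j _ _ gij.
have nd x : [set x : ray G] `&` [set x] <> set0.
  by rewrite setIid => x0; suff : set0 x by []; rewrite -x0.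
by case: (ltngtP i j) => // /gd; rewrite gij => /nd.
Qed.

Lemma deg_geP (G : sgraph) (w : set (ray G)) n : w !=set0 ->
  ((Posz n)%:E <= deg w)%E <-> exists g, disjoint_family w n g.
Proof.
move=> w0; rewrite /deg; set E := [set ecard F | F in _].
have EP m : (exists g, disjoint_family w m g) -> E (Posz m)%:E%E.
  move=> [g [gw gd]]; exists (g @` `I_m).
    split=> [_ [i im <-]|_ _ [i im <-] [j jm <-] [x [[a _ ga] [b _ gb]]]].
      exact: gw.
    by rewrite (gd i j a b) // ga.
  apply: ecard_fin; apply: inj_card_eq => i j; rewrite !inE => im jm gij.
  by apply: (gd i j 0%N 0%N) => //; rewrite gij.
have Ege e m : E e -> ((Posz m)%:E <= e)%E -> exists g, disjoint_family w m g.
  by move=> [F [Fw Fd] <-]; exact: ecard_disjoint_family.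
have Ub m : ~ (exists g, disjoint_family w m.+1 g) -> ubound E (Posz m)%:E%E.
  move=> nm _ [F [Fw Fd] <-]; rewrite leNgt; apply/negP => mF; apply: nm.
  apply: ecard_disjoint_family Fw Fd w0 _; move: mF.
  have [[q Fq]|/ecard_infty->] := pselect (finite_set F); last by rewrite leey.
  by rewrite (ecard_fin Fq) lte_fin ltz_nat lee_posz.
have fam0 : exists g, disjoint_family w 0 g.
  by have [r0 _] := w0; exists (fun=> r0); split.
have E0 : E (Posz 0)%:E%E by exact: EP.
(* The supremum is [+oo] if families of all finite sizes exist; otherwise it is one less than the
   least size that fails, which is positive because of the empty family. *)
have : supremums E (supremum 0%E E).
  rewrite /supremum; case: eqP => [E00|_]; first by rewrite E00 in E0.
  apply: xgetPex; have [all|/existsNP exm] :=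
      pselect (forall m, exists g, disjoint_family w m g).
    exists +oo%E; split=> [e _|u uE]; first exact: leey.
    case: u uE => [z| |] uE //.
      have := uE _ (EP _ (all `|z|%N.+1)); rewrite lee_fin; lia.
    by have := uE _ E0.
  have {}exm : exists m, `[< ~ exists g, disjoint_family w m g >].
    by have [m nm] := exm; exists m; apply/asboolP.
  have [[|m] /asboolP nm mmin] := ex_minnP exm; first by case: nm.
  exists (Posz m)%:E%E; split=> [|u uE]; first exact: Ub.
  apply: uE; apply: EP; apply: contrapT => nm'.
  by have := mmin m; rewrite ltnn => /(_ (asboolT nm')).
move=> [supub suplb]; split=> [|/EP/supub//].
case: n => [//|n] nsup; apply: contrapT => /Ub/suplb/(le_trans nsup).
by rewrite lee_posz ltnn.
Qed.

(** * The topology on separations *)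

Section Topology.
Variable G : sgraph.
Implicit Types (s t : fsep G) (T : set (fsep G)) (Z : set G).

Lemma nbhs_basic_open Z s : finite_set Z ->
  nbhs s (basic_open Z (lside s `&` Z) (rside s `&` Z)).
Proof.
move=> finZ; set U := basic_open _ _ _; exists U; split=> //.
exists [set U]; last by rewrite bigcup_set1.
move=> _ ->; exists Z, (lside s `&` Z), (rside s `&` Z); split=> //.
exact: is_sep_restr.
Qed.

(** The separations agreeing with [s] on a finite [Z] form a neighbourhood base of [s]. *)
Lemma fsep_closedP T : closed T <->
  forall s, (forall Z, finite_set Z -> exists2 t, T t &
    lside t `&` Z = lside s `&` Z /\ rside t `&` Z = rside s `&` Z) -> T s.
Proof.
split=> [clT s sT|H s sT]; last first.
  apply: H => Z finZ; have [t [Tt tZ]] := sT _ (nbhs_basic_open s finZ).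
  by exists t.
apply: clT => B [O [[O' O'base <-] [U O'U Us] OB]].
have [Z [A [C [finZ _ UE]]]] := O'base _ O'U; move: Us; rewrite UE => -[sA sC].
have [t Tt [tA tC]] := sT Z finZ; exists t; split=> //; apply: OB.
by exists U => //; rewrite UE; split; rewrite ?tA ?tC.
Qed.

End Topology.

(** * Closedness of the end tangle *)

Section Tangle.
Variables (G : sgraph) (r : ray G).
Let w : set (ray G) := [set r' | ray_equiv r r'].
Implicit Types (A B F X Z : set G) (s t : fsep G) (k : nat).

Lemma end_refl : w r.
Proof. by apply/ray_equivP => F /(ray_home r). Qed.

Lemma is_sepC A B : is_sep setT A B -> is_sep setT B A.
Proof.
move=> [AB noe]; split=> [|x y xB yA]; first by rewrite setUC.
by rewrite adj_sym; exact: noe.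
Qed.

Lemma linked_side A B F x y : is_sep setT A B -> A `&` B `<=` F ->
  linked F x y -> (A `\` B) x -> (A `\` B) y.
Proof.
move=> [AB noe] ABF xy xA; move: xy; apply: linked_ind => // u v [Au nBu] uv _ Fv.
have : setT v by []; rewrite -AB => -[Av|Bv].
  by split=> // Bv; apply: Fv; exact: ABF.
have nAv : ~ A v by move=> Av; apply: Fv; exact: ABF.
by have := noe u v (conj Au nBu) (conj Bv nAv); rewrite uv.
Qed.

Lemma connected_side A B X : is_sep setT A B ->
    (forall x y, X x -> X y -> linked (~` X) x y) -> X `&` (A `&` B) = set0 ->
  X `<=` A `\` B \/ X `<=` B `\` A.
Proof.
move=> sepAB conX XAB.
have ABX : A `&` B `<=` ~` X.
  by move=> x ABx Xx; suff : set0 x by []; rewrite -XAB.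
have [[x [Xx xA]]|nx] := pselect (exists x, X x /\ (A `\` B) x).
  by left=> y Xy; apply: linked_side (conX _ _ Xx Xy) xA.
right=> y Xy; have [AB _] := sepAB; have : setT y by []; rewrite -AB.
have nyA : ~ A y.
  by move=> Ay; apply: nx; exists y; split=> //; split=> // By; apply: (ABX y).
by case.
Qed.

Lemma home_connected F x y : home r F x -> home r F y -> linked (~` home r F) x y.
Proof.
move=> Fx Fy; have := home_linked Fx Fy => xy.
suff [] : linked (~` home r F) x y /\ home r F y by [].
move: xy; apply: (@linked_ind _ F (fun y => linked (~` home r F) x y /\ home r F y)).
  by split=> //; apply: linked_refl.
move=> u v [xu Fu] uv _ Fv; have Hv := home_step Fu uv Fv.
by split=> //; apply: linked_step xu uv _.
Qed.

Lemma home_side s : home r (lside s `&` rside s) `<=` lside s `\` rside s \/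
  home r (lside s `&` rside s) `<=` rside s `\` lside s.
Proof.
apply: connected_side; [exact: fsep_sep|exact: home_connected|].
by rewrite -subset0 => x [/homeN].
Qed.

(** The home of the separator is connected and misses it, so it lies strictly on one side; every ray
    of the end has a tail there. *)
Lemma end_tangleP s :
  end_tangle w s <-> home r (lside s `&` rside s) `<=` rside s `\` lside s.
Proof.
split=> [sw|sr r' /ray_equivP/(_ _ (fsep_fin s))[n nr]]; last first.
  by exists n => m /nr/sr[].
have [sl|//] := home_side s.
have [n nr] := ray_home r (fsep_fin s); have [n' nr'] := sw _ end_refl.
have [] := sl _ (nr (maxn n n') (leq_maxl _ _)).
by move=> _ []; apply: nr'; exact: leq_maxr.
Qed.

Lemma dominates_rside s v : end_tangle w s -> dominates v w -> rside s v.
Proof.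
move=> /end_tangleP sr /dominatesP/(_ _ (fsep_fin s))[u /sr[ru nlu] vu].
have [lr noe] := fsep_sep s; apply: contrapT => nrv.
have : setT v by []; rewrite -lr => -[lv|//].
by have := noe v u (conj lv nrv) (conj ru nlu); rewrite vu.
Qed.

Lemma fsep_ltP k s :
  fsep_lt k s <-> (fcard (lside s `&` rside s) < k)%N.
Proof.
by split=> [/card_lt_II[]//|sk]; apply/card_lt_II; split=> //; exact: fsep_fin.
Qed.

Lemma decider_closed k X : finite_set X ->
  relative_decider (end_tangle w `&` fsep_lt k) X ->
  closed (end_tangle w `&` fsep_lt k).
Proof.
move=> finX decX; apply/fsep_closedP => s sT.
have sk : fsep_lt k s.
  apply/fsep_ltP; have [t [_ /fsep_ltP tk] [tl tr]] := sT _ (fsep_fin s).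
  apply: leq_ltn_trans tk; apply: fcard_sub; first exact: fsep_fin.
  move=> x [lx rx]; split.
    have : (lside s `&` (lside s `&` rside s)) x by [].
    by rewrite -tl => -[].
  have : (rside s `&` (lside s `&` rside s)) x by [].
  by rewrite -tr => -[].
split=> //; apply/end_tangleP; have [sl|//] := home_side s.
have fin' : finite_set (rside s `&` lside s) by rewrite setIC; exact: fsep_fin.
(* Were the end on the left of [s], the inverse of [s] would be in the tangle, and [X] would give
   opposite strict inequalities for it and for a nearby [t]. *)
pose s' := FSep (is_sepC (fsep_sep s)) fin'.
have s'T : (end_tangle w `&` fsep_lt k) s'.
  split; first by apply/end_tangleP; rewrite /= setIC.
  by move/fsep_ltP: sk => sk; apply/fsep_ltP; rewrite /= setIC.
have [t /decX + [tl tr]] := sT X finX; rewrite tl tr.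
have := decX _ s'T; have finI Y : finite_set (Y `&` X).
  by apply: sub_finite_set finX => x [].
by rewrite /= !card_ltE //; lia.
Qed.

Lemma closed_deg_dom k : closed (end_tangle w `&` fsep_lt k) ->
  ((Posz k)%:E <= deg w + dom w)%E.
Proof.
have w0 : w !=set0 by exists r; exact: end_refl.
have deg0 : ((Posz 0)%:E <= deg w)%E.
  by apply/deg_geP => //; exists (fun=> r); split.
move=> clT; rewrite /dom; set D := [set v | dominates v w].
have [finD|infD] := pselect (finite_set D); last first.
  by rewrite (ecard_infty infD) addey ?leey //; case: (deg w) deg0.
have Dl := fcard_II finD; rewrite (ecard_fin Dl); set l := fcard D in Dl *.
have [degk|/deg_geP nodeg] := pselect ((Posz (k - l))%:E <= deg w)%E.
  apply: le_trans (leeD2r _ degk); rewrite -EFinD lee_fin; lia.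
have sepD : is_sep setT setT D.
  by split=> [|x y _ [_ ny]]; [rewrite setTU|case: ny].
have finTD : finite_set (setT `&` D) by rewrite setTI.
(* It suffices to put [(V, D)] in the closure: [r] has no tail in the finite set [D], so this
   separation is not in the tangle. *)
have [|/(_ r end_refl)[n /= nD] _] := (fsep_closedP _).1 clT (FSep sepD finTD); last first.
  by have [n' n'D] := ray_avoids r finD; case: (n'D (maxn n n')); [exact: leq_maxr|apply: nD; exact: leq_maxl].
move=> Z finZ /=.
have [|S [finS Sk SZD ZS]] := @end_separator _ r Z (k - l) finD finZ.
  by move=> g gw gd; apply: (nodeg w0); exists g.
set C := home r (D `|` S) in ZS.
have finDS : finite_set (D `|` S) by rewrite finite_setU.
(* As [Z] misses [C] and [S], this separation agrees with [(V, D)] on [Z]; its separator lies in the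
   union of [D] and [S], which has fewer than [k] vertices. *)
have sepC : is_sep setT (~` C) (C `|` (D `|` S)).
  split=> [|x y [nCx nx] [_ /contrapT Cy]].
    by apply/seteqP; split=> // x _; have [Cx|nCx] := pselect (C x); [right; left|left].
  apply/negP => xy; apply: nCx; apply: home_step Cy _ _; first by rewrite adj_sym.
  by move=> ?; apply: nx; right.
have subDS : ~` C `&` (C `|` (D `|` S)) `<=` D `|` S by move=> x [nCx []].
have finC : finite_set (~` C `&` (C `|` (D `|` S))) by exact: sub_finite_set finDS.
exists (FSep sepC finC); first split.
- by move=> r' /ray_equivP/(_ _ finDS)[n nC]; exists n => m /nC; left.
- apply/fsep_ltP; apply: leq_ltn_trans (fcard_sub finDS subDS) _.
  by apply: leq_ltn_trans (fcardU_le finD finS) _; rewrite -/l; lia.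
split=> /=.
  apply/seteqP; split=> x [_ Zx]; split=> // Cx.
  by suff : set0 x by []; rewrite -ZS.
apply/seteqP; split=> x [xC Zx]; split=> //; last by right; left.
case: xC => [Cx|[//|Sx]]; first by suff : set0 x by []; rewrite -ZS.
by suff : set0 x by []; rewrite -SZD; split=> //; left.
Qed.

End Tangle.

(** * Deciders from disjoint rays and dominating vertices *)

Lemma fcard_inj (T U : choiceType) (f : T -> U) (A : set T) : finite_set A ->
  {in A &, injective f} -> fcard (f @` A) = fcard A.
Proof.
by move=> finA finj; apply/fcard_eq => //; [exact: finite_image|exact: inj_card_eq].
Qed.

Lemma card_eq_image_II (T : choiceType) (x : nat -> T) n :
  (forall i j, (i < n)%N -> (j < n)%N -> x i = x j -> i = j) ->
  x @` `I_n #= `I_n.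
Proof. by move=> xinj; apply: inj_card_eq => i j; rewrite !inE; exact: xinj. Qed.

Lemma fcard_inj_ge (T : choiceType) (A : set T) (x : nat -> T) n : finite_set A ->
    (forall i, (i < n)%N -> A (x i)) ->
    (forall i j, (i < n)%N -> (j < n)%N -> x i = x j -> i = j) ->
  (n <= fcard A)%N.
Proof.
move=> finA xA xinj; rewrite -(card_fset_set (card_eq_image_II xinj)).
by apply: fcard_sub => // _ [i /xA ? <-].
Qed.

Lemma ecard_enum (T : choiceType) (x0 : T) (A : set T) n :
    ((Posz n)%:E <= ecard A)%E ->
  exists x : nat -> T, (forall i, (i < n)%N -> A (x i)) /\
    (forall i j, (i < n)%N -> (j < n)%N -> x i = x j -> i = j).
Proof.
move=> nA; have [B BA nB] : exists2 B : {fset T}, [set` B] `<=` A & (n <= #|` B|)%N.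
  have [finA|infA] := pselect (finite_set A); last exact: infinite_set_fset.
  exists (fset_set A); first by rewrite fset_setK.
  by move: nA; rewrite (ecard_fin (fcard_II finA)) lee_posz.
exists (nth x0 B); split=> [i ni|i j ni nj /eqP].
  by apply: BA; apply: mem_nth; exact: leq_trans nB.
by rewrite nth_uniq ?fset_uniq => [/eqP|||]//; exact: leq_trans nB.
Qed.

(** A discrete intermediate value argument: no edge of the ray jumps over the separator. *)
Lemma ray_cross (G : sgraph) (r : ray G) (A B : set G) a b : is_sep setT A B ->
    (a <= b)%N -> A (r a) -> B (r b) ->
  exists c, [/\ (a <= c)%N, (c <= b)%N & (A `&` B) (r c)].
Proof.
move=> [AB noe] /subnKC; move: (b - a)%N => d; elim: d a => [|d IH] a.
  by rewrite addn0 => <- Aa Ba; exists a.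
rewrite addnS -addSn => ab Aa Bb.
have [Ba|nBa] := pselect (B (r a)); first by exists a; split=> //; lia.
have [|c [ac cb ABc]] := IH a.+1 ab _ Bb; last by exists c; split=> //; lia.
apply: contrapT => nA1; have : setT (r a.+1) by [].
rewrite -AB => -[//|B1].
by have := noe _ _ (conj Aa nBa) (conj B1 nA1); rewrite ray_adj.
Qed.

Section Decider.
Variables (G : sgraph) (r : ray G).
Let w : set (ray G) := [set r' | ray_equiv r r'].
Implicit Types (A B F X Z : set G) (s : fsep G) (k : nat).

Lemma disjoint_family_avoid n g F : finite_set F -> disjoint_family w n g ->
  exists g', disjoint_family w n g' /\
    forall i a, (i < n)%N -> ~ F (g' i a).
Proof.
move=> finF [gw gd].
have /choice[N NP] : forall i, exists N, forall m, (N <= m)%N -> ~ F (g i m).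
  by move=> i; exact: ray_avoids.
have inj i : injective (fun a => g i (N i + a)%N).
  by move=> a b /ray_inj/addnI.
have adj' i a : adj (g i (N i + a)%N) (g i (N i + a.+1)%N).
  by rewrite addnS; exact: ray_adj.
exists (fun i => Ray (inj i) (adj' i)); split; [split|].
- move=> i /gw/ray_equivP iw; apply/ray_equivP => W /iw[n' n'W].
  by exists n' => m n'm; apply: n'W; apply: leq_trans n'm (leq_addl _ _).
- by move=> i j a b ni nj; exact: gd.
- by move=> i a ni /=; apply: NP; exact: leq_addr.
Qed.

Lemma finite_connected F Z : finite_set Z -> Z `<=` home r F ->
  exists L, [/\ Z `<=` L, finite_set L, L `&` F = set0 &
    forall x y, L x -> L y -> linked (~` L) x y].
Proof.
move=> finZ ZF; have [->|/set0P[b Zb]] := eqVneq Z set0.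
  by exists set0; split=> //; rewrite ?set0I.
have /choice[p pP] : forall x, exists p : seq G, Z x ->
    [/\ path (@adj G) b p, last b p = x & forall z, z \in b :: p -> ~ F z].
  move=> x; have [Zx|nZ] := pselect (Z x); last by exists [::].
  by have [p pF] := home_linked (ZF _ Zb) (ZF _ Zx); exists p.
pose L := [set y | exists2 x, Z x & y \in b :: p x].
have bL y : L y -> linked (~` L) b y.
  move=> [x Zx yp]; have [bp _ _] := pP x Zx.
  have: forall z, z \in b :: p x -> L z by exists x.
  case/splitPl: yp bp => p1 p2 p1y; rewrite cat_path => /andP[bp1 _] pL.
  exists p1; split=> // z zp1; apply; apply: pL.
  by rewrite -cat_cons mem_cat zp1.
exists L; split.
- by move=> x Zx; exists x => //; have [_ + _] := pP x Zx; have := mem_last b (p x) => /[swap] ->.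
- have -> : L = \bigcup_(x in Z) [set` b :: p x].
    by apply/seteqP; split=> y [x Zx xy]; exists x.
  by apply: bigcup_finite => // x _; exact: finite_seq.
- by rewrite -subset0 => y [[x Zx yx] Fy]; have [_ _ /(_ _ yx)] := pP x Zx.
- by move=> x y /bL bx /bL; apply: linked_trans; exact: linked_sym.
Qed.

(** A vertex of each ray and a neighbour of each [d j] are taken in the home of the earlier levels
    and joined by paths there. *)
Lemma exists_levels m l (g : nat -> ray G) (d : nat -> G) :
    (forall i, (i < m)%N -> w (g i)) ->
    (forall j, (j < l)%N -> dominates (d j) w) ->
  exists L : nat -> set G, (forall t, [/\ finite_set (L t),
      forall x y, L t x -> L t y -> linked (~` L t) x y,
      forall i, (i < m)%N -> exists a, L t (g i a) &
      forall j, (j < l)%N -> exists2 u, L t u & adj (d j) u]) /\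
    forall t t', (t < t')%N -> L t `&` L t' = set0.
Proof.
move=> gw dD.
have [|L [LP Ld]] := @disjoint_seq (set G) G (fun L => [/\ finite_set L,
      forall x y, L x -> L y -> linked (~` L) x y,
      forall i, (i < m)%N -> exists a, L (g i a) &
      forall j, (j < l)%N -> exists2 u, L u & adj (d j) u]) id; last by exists L.
move=> F finF.
have /choice[a aP] : forall i, exists a, (i < m)%N -> home r F (g i a).
  move=> i; case: (ltnP i m) => [/gw/ray_equivP/(_ F finF)[n nF]|]; last by exists 0%N.
  by exists n => _; exact: nF.
have /choice[u uP] : forall j, exists u, (j < l)%N -> home r F u /\ adj (d j) u.
  move=> j; case: (ltnP j l) => [/dD/dominatesP/(_ F finF)[u uF du]|].
    by exists u.
  by exists (r 0%N).
pose Z := ((fun i => g i (a i)) @` `I_m) `|` (u @` `I_l).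
have [||L [ZL finL LF conL]] := @finite_connected F Z.
- by rewrite finite_setU; split; exact: finite_image.
- by move=> _ [[i /aP ? <-]|[j /uP[? _] <-]].
exists L; split=> //; split=> // [i im|j jl].
  by exists (a i); apply: ZL; left; exists i.
by exists (u j); [apply: ZL; right; exists j|have [] := uP j jl].
Qed.

(* X consists of the d j and of one vertex on each ray g i beyond m + l disjoint
   connected levels, each meeting all rays and sending an edge to each d j. A
   separation of order less than m + l misses some level. If this level is in
   A - B, then every ray and every d j meets A n B, which is too small. If it is
   in B - A, then every ray with its vertex of X in A meets A n B after that
   vertex, and even before it when the vertex is in A - B; hence
   |A n X| + |X - B| <= |A n B| < |X|. *)
Lemma family_decider m l (g : nat -> ray G) (d : nat -> G) :
    disjoint_family w m g -> (forall j, (j < l)%N -> dominates (d j) w) ->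
    (forall i j, (i < l)%N -> (j < l)%N -> d i = d j -> i = j) ->
  exists2 X : set G, X #= `I_(m + l) &
    relative_decider (end_tangle w `&` fsep_lt (m + l)) X.
Proof.
move=> gfam dD dinj; set k := (m + l)%N.
(* Passing to tails that avoid every [d j] makes the tracks below disjoint. *)
have [g' [[gw gd] gnd]] :=
  disjoint_family_avoid (finite_image d (finite_II l)) gfam.
move: g' gw gd gnd {g gfam} => g gw gd gnd.
have [L [LP Ld]] := exists_levels gw dD.
have finL : finite_set (\bigcup_(t in `I_k) L t).
  by apply: bigcup_finite => // t _; have [] := LP t.
have /choice[N NP] : forall i, exists N, forall a, (N <= a)%N ->
    ~ (\bigcup_(t in `I_k) L t) (g i a).
  by move=> i; exact: ray_avoids.
(* Index [i < m] stands for a ray and [m + j] for [d j]. Vertices chosen on distinct tracks are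
   distinct, which drives all the counting. *)
pose track i y := if (i < m)%N then range (g i) y else y = d (i - m)%N.
have trackI i j y : (i < k)%N -> (j < k)%N -> track i y -> track j y -> i = j.
  rewrite /track => ik jk.
  have ndr i' j' y' : (i' < m)%N -> (m <= j')%N -> (j' < k)%N ->
      range (g i') y' -> y' <> d (j' - m)%N.
    move=> im mj j'k [a _ <-] E; apply: (gnd i' a im); rewrite E.
    by exists (j' - m)%N => //=; rewrite /k in j'k; lia.
  case: (ltnP i m) => im; case: (ltnP j m) => jm.
  - by move=> [a _ <-] [b _ E]; apply: (gd i j a b).
  - by move=> /(ndr _ _ _ im jm jk).
  - by move=> yd /(ndr _ _ _ jm im ik).
  - move=> -> /dinj; rewrite /k in ik jk *; lia.
pose x i := if (i < m)%N then g i (N i) else d (i - m)%N.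
have xtrack i : track i (x i) by rewrite /track /x; case: (i < m)%N.
have xinj i j : (i < k)%N -> (j < k)%N -> x i = x j -> i = j.
  by move=> ik jk E; apply: (@trackI i j (x i)) => //; rewrite E.
pose X := x @` `I_k.
have Xk : X #= `I_k by exact: card_eq_image_II.
exists X => // s [sw /fsep_ltP sk].
have sepAB := fsep_sep s; have finO := fsep_fin s.
have dB j : (j < l)%N -> rside s (d j) by move=> /dD; exact: dominates_rside.
set A := lside s in sepAB finO sk *; set B := rside s in sepAB finO dB sk *.
set O := A `&` B in finO sk.
have tailB i : (i < m)%N -> tail_in (g i) B by move=> /gw; exact: sw.
have [AB noe] := sepAB.
have [t tk LO] : exists2 t, (t < k)%N & L t `&` O = set0.
  apply: contrapT => nt.
  have /choice[y yP] : forall t, exists y, (t < k)%N -> L t y /\ O y.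
    move=> t; case: (ltnP t k) => tk; last by exists (r 0%N).
    apply: contrapT => /forallNP ny; apply: nt; exists t => //.
    rewrite -subset0 => y ?; by apply: (ny y).
  suff : (k <= fcard O)%N by rewrite leqNgt sk.
  apply: (@fcard_inj_ge _ O y) => // [i /yP[]//|i j ik jk E].
  have [Li _] := yP i ik; have [Lj _] := yP j jk.
  case: (ltngtP i j) => // ij; suff : set0 (y i) by [].
    by rewrite -(Ld _ _ ij); split=> //; rewrite E.
  by rewrite -(Ld _ _ ij); split=> //; rewrite E.
have [_ conL Lg LdP] := LP t.
have gt i a : L t (g i a) -> (a < N i)%N.
  by move=> La; rewrite ltnNge; apply/negP => /NP; apply; exists t.
case: (connected_side sepAB conL LO) => LAB.
  have /choice[y yP] : forall i, exists y, (i < k)%N -> O y /\ track i y.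
    move=> i; case: (ltnP i k) => ik; last by exists (r 0%N).
    case: (ltnP i m) => im; rewrite /track.
      have [a /LAB[Aa _]] := Lg i im; have [n nB] := tailB i im.
      have [c [_ _ Oc]] := ray_cross sepAB (leq_maxl a n) Aa (nB _ (leq_maxr _ _)).
      by exists (g i c) => _; rewrite im; split=> //; exists c.
    exists (d (i - m)%N); rewrite ltnNge im; split=> //.
    have il : (i - m < l)%N by rewrite /k in ik; lia.
    split; last exact: dB.
    have [u /LAB uA du] := LdP _ il; apply: contrapT => nA.
    by have := noe _ _ uA (conj (dB _ il) nA); rewrite adj_sym du.
  suff : (k <= fcard O)%N by rewrite leqNgt sk.
  apply: (@fcard_inj_ge _ O y) => // [i /yP[]//|i j ik jk E].
  by apply: (@trackI i j (y i)) => //; [have [] := yP i ik|rewrite E; have [] := yP j jk].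
pose late i y := if (i < m)%N then exists2 b, (N i <= b)%N & y = g i b
  else y = d (i - m)%N.
have /choice[f fP] : forall v, exists y, (A `&` X) v ->
    O y /\ exists i, [/\ (i < k)%N, v = x i & late i y].
  move=> v; have [[Av [i ik xv]]|nv] := pselect ((A `&` X) v); last by exists v.
  move: Av; rewrite -xv /x /late; case: (ltnP i m) => im Av.
    have [n nB] := tailB i im.
    have [c [Nc _ Oc]] := ray_cross sepAB (leq_maxl (N i) n) Av (nB _ (leq_maxr _ _)).
    exists (g i c) => _; split=> //; exists i; rewrite im; split=> //.
    by exists c.
  exists (d (i - m)%N) => _; split; last by exists i; rewrite (ltnNge i m) im.
  by split=> //; apply: dB; rewrite /k /= in ik; lia.
pose XA := X `&` (A `\` B).
(* Level [t] is in [B - A] and meets the ray before its vertex of [X], so a crossing occurs in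
   between. It is strictly earlier than that vertex, which is not in [B], hence differs from the
   late crossings. *)
have /choice[h hP] : forall v, exists y, XA v ->
    O y /\ exists i b, [/\ (i < m)%N, v = x i, (b < N i)%N & y = g i b].
  move=> v; have [[[i ik xv] [Av nBv]]|nv] := pselect (XA v); last by exists v.
  move: Av nBv; rewrite -xv /x; case: (ltnP i m) => im Av nBv; last first.
    by case: nBv; apply: dB; rewrite /k /= in ik; lia.
  have [a /[dup] /gt aN /LAB[Ba _]] := Lg i im.
  have [c [_ cN Oc]] := ray_cross (is_sepC sepAB) (ltnW aN) Ba Av.
  exists (g i c) => _; split; first by rewrite /O setIC.
  exists i, c; rewrite im; split=> //; rewrite ltn_neqAle cN andbT.
  by apply/eqP => cE; apply: nBv; rewrite -cE; have [] := Oc.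
have finX : finite_set X by exists k.
have finAX : finite_set (A `&` X) by apply: sub_finite_set finX => v [].
have finBX : finite_set (B `&` X) by apply: sub_finite_set finX => v [].
have finXA : finite_set XA by apply: sub_finite_set finX => v [].
have late_track i y : late i y -> track i y.
  by rewrite /late /track; case: ifP => // _ [b _ ->]; exists b.
rewrite card_ltE //.
have fcf : fcard (f @` (A `&` X)) = fcard (A `&` X).
  apply: fcard_inj => // u v; rewrite !inE => /fP[_ [i [ik ui iu]]] /fP[_ [j [jk vj jv]]] E.
  by rewrite ui vj; congr x; apply: (@trackI i j (f u)) => //; [|rewrite E]; exact: late_track.
have fch : fcard (h @` XA) = fcard XA.
  apply: fcard_inj => // u v; rewrite !inE.
  move=> /hP[_ [i [a [im ui _ hu]]]] /hP[_ [j [b [jm vj _ hv]]]] E.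
  by rewrite ui vj; congr x; apply: (gd i j a b) => //; rewrite -hu -hv.
have le1 : (fcard (A `&` X) + fcard XA <= fcard O)%N.
  rewrite -fcf -fch -fcardU; [|exact: finite_image|exact: finite_image|].
    apply: fcard_sub => // _ [[v /fP[? _] <-]|[v /hP[? _] <-]] //.
  rewrite -subset0 => _ [[v /fP[_ [i [ik _ iv]]] <-] [u /hP[_ [j [b [jm _ bN hu]]]] E]].
  have jk : (j < k)%N by rewrite /k; lia.
  have ij : i = j.
    apply: (@trackI i j (f v)) => //; first exact: late_track.
    by rewrite /track jm -E hu; exists b.
  move: iv; rewrite /late ij jm => -[b' Nb']; rewrite -E hu => /ray_inj bb'; lia.
have le2 : (fcard (B `&` X) + fcard XA = k)%N.
  rewrite -fcardU //; last by rewrite -subset0 => v [[Bv _] [_ [_]]].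
  rewrite -[RHS](card_fset_set Xk); congr fcard; apply/seteqP; split=> v.
    by move=> [[]|[]].
  move=> Xv; have [Bv|nBv] := pselect (B v); [by left|right; split=> //; split=> //].
  by have : setT v by []; rewrite -AB => -[].
(* |A n X| + |XA| <= |O| < k = |B n X| + |XA|, and |XA| cancels. *)
lia.
Qed.

Lemma deg_dom_decider k : ((Posz k)%:E <= deg w + dom w)%E ->
  exists2 X : set G, X #= `I_k & relative_decider (end_tangle w `&` fsep_lt k) X.
Proof.
have w0 : w !=set0 by exists r; exact: end_refl.
move=> kdd; suff [m [l [<- mdeg ldom]]] : exists m l, [/\ (m + l)%N = k,
    ((Posz m)%:E <= deg w)%E & ((Posz l)%:E <= dom w)%E].
  have [g gfam] := (deg_geP _ w0).1 mdeg.
  have [d [dD dinj]] := ecard_enum (r 0%N) ldom.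
  exact: family_decider gfam dD dinj.
have deg0 : ((Posz 0)%:E <= deg w)%E.
  by apply/deg_geP => //; exists (fun=> r); split.
(* With at least [k] dominating vertices no ray is used. Otherwise all [q] of them are used, and
   [k - q] rays make up the rest. *)
have [kdom|] := leP (Posz k)%:E%E (dom w); first by exists 0%N, k.
move: kdd; rewrite /dom; have [[q Dq]|/ecard_infty->] :=
  pselect (finite_set [set v | dominates v w]); last by [].
rewrite (ecard_fin Dq) => kdd; rewrite lte_fin ltz_nat => qk.
exists (k - q)%N, q; split=> //; first by lia.
move: kdd; case: (deg w) deg0 => [z| |]; rewrite -?EFinD ?lee_fin ?leey //; lia.
Qed.

End Decider.

(** * The cycle of implications *)

Theorem theorem4p5 (G : sgraph) (G_inf : infinite_set [set: G])
    (w : set (ray G)) (w_end : is_end w) (k : nat) :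
  let T := end_tangle w `&` fsep_lt k in
  [<-> closed T;
       ((Posz k)%:E <= deg w + dom w)%E;
       exists2 X : set G, finite_set X & relative_decider T X;
       exists2 X : set G, X #= `I_k & relative_decider T X].
Proof.
have [r ->] := w_end => T; tfae.
- exact: closed_deg_dom.
- by move=> /deg_dom_decider[X Xk XT]; exists X => //; exists k.
(* A finite decider has no prescribed size; going back through closedness and the bound on degree
   and domination yields one of size [k]. *)
- by move=> [X finX /(decider_closed finX)/closed_deg_dom/deg_dom_decider].
- by move=> [X Xk]; apply: decider_closed; exists k.
Qed.
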